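(* The squarefree part of every weakly polymatroidal ideal is again weakly polymatroidal.
   Context: $K$ is a field and $R=K[x_1,\ldots,x_n]$ with variables ordered $x_1>\cdots>x_n$ (the same order is used for both ideals). A monomial ideal $I\subset R$ generated in one degree, with minimal monomial generating set $G(I)$, is weakly polymatroidal if for any two monomials $u=x_1^{a_1}\cdots x_n^{a_n}$ and $v=x_1^{b_1}\cdots x_n^{b_n}$ in $G(I)$ for which there is an integer $t$ with $a_1=b_1,\ldots,a_{t-1}=b_{t-1}$ and $a_t>b_t$, there exists $\ell>t$ such that $x_\ell$ divides $v$ and $x_t(v/x_\ell)\in I$. The squarefree part of a monomial ideal $I$ generated in one degree is the ideal generated by all squarefree monomials in $G(I)$. *)

(* Defs.v *)
From HB Require Import structures.
From Stdlib Require Import Classical_Prop.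
From mathcomp Require Import all_boot all_order all_algebra.
From mathcomp Require Import mpoly.

Set Implicit Arguments.
Unset Strict Implicit.
Unset Printing Implicit Defensive.

Import GRing.Theory.
Local Open Scope ring_scope.

(* Ideals are Prop-valued predicates on the polynomial ring, since idealr of
   ring_quotient only covers boolean predicates and excludes the whole ring.
   A monomial is identified with its exponent vector m : 'X_{1..n}, and x_i
   with 'X_i for i : 'I_n, so x_1 > ... > x_n is increasing order of indices. *)
Section MonomialIdeals.

Variables (K : fieldType) (n : nat).
Implicit Types (I J : {mpoly K[n]} -> Prop) (S T : 'X_{1..n} -> Prop).
Implicit Types (f g : {mpoly K[n]}) (m : 'X_{1..n}).

Definition is_ideal I : Prop :=
  [/\ I 0, forall f g, I f -> I g -> I (f + g) & forall f g, I g -> I (f * g)].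

(* The smallest ideal containing the monomials in S. *)
Definition ideal_of S : {mpoly K[n]} -> Prop := fun f =>
  forall J, is_ideal J -> (forall m, S m -> J 'X_[m]) -> J f.

Definition generates S I : Prop := forall f, I f <-> ideal_of S f.

Definition monomial_ideal I : Prop := exists S, generates S I.

Definition minimal_generating S I : Prop :=
  generates S I /\
  forall T, (forall m, T m -> S m) -> generates T I -> forall m, S m -> T m.

(* G(I).  A monomial ideal has exactly one minimal set of monomial generators,
   see mingens_minimal and minimal_generating_uniq below. *)
Definition mingens I : 'X_{1..n} -> Prop := fun m =>
  exists2 S, minimal_generating S I & S m.

(* The zero ideal, which has no generators, qualifies. *)
Definition generated_in_one_degree I : Prop :=
  exists d : nat, forall m, mingens I m -> mdeg m = d.

Definition weakly_polymatroidal I : Prop :=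
  [/\ monomial_ideal I,
      generated_in_one_degree I
    & forall u v, mingens I u -> mingens I v ->
      forall t : 'I_n,
        (forall i : 'I_n, (i < t)%N -> u i = v i) -> (v t < u t)%N ->
      exists l : 'I_n,
        [/\ (t < l)%N, (U_(l) <= v)%MM & I ('X_t * 'X_[v - U_(l)])]].

Definition squarefree m : Prop := forall i : 'I_n, (m i <= 1)%N.

Definition squarefree_part I : {mpoly K[n]} -> Prop :=
  ideal_of (fun m => mingens I m /\ squarefree m).

Lemma ideal_of_ideal S : is_ideal (ideal_of S).
Proof.
split=> [J [] //|f g If Ig J HJ SJ|f g Ig J HJ SJ]; case: (HJ) => _ HD HM.
  by apply: HD; [apply: If | apply: Ig].
by apply: HM; apply: Ig.
Qed.

Lemma ideal_of_gen S m : S m -> ideal_of S 'X_[m].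
Proof. by move=> Sm J _; apply. Qed.

Lemma ideal_ofXP S m :
  ideal_of S 'X_[m] <-> exists2 s, S s & (s <= m)%MM.
Proof.
split=> [Im|[s Ss le_sm]]; last first.
  have [_ _ HM] := ideal_of_ideal S.
  by rewrite -(submK le_sm) mpolyXD; apply: HM; apply: ideal_of_gen.
pose J (f : {mpoly K[n]}) :=
  forall m', m' \in msupp f -> exists2 s, S s & (s <= m')%MM.
suff: J 'X_[m] by apply; rewrite msuppX mem_head.
apply: Im.
- split=> [m'|f g Jf Jg m'|f g Jg m']; first by rewrite msupp0.
    by move/msuppD_le; rewrite mem_cat => /orP[/Jf|/Jg].
  move/msuppM_le/allpairsP => [[m1 m2]] /= [_ /Jg[s Ss le_s] ->].
  by exists s => //; apply: lepm_trans le_s (lem_addl _ _).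
- by move=> s Ss m'; rewrite msuppX mem_seq1 => /eqP->; exists s => //; apply: lepm_refl.
Qed.

Lemma minimal_generatingE S I :
  minimal_generating S I ->
  forall m, S m <->
    I 'X_[m] /\ forall m', I 'X_[m'] -> (m' <= m)%MM -> m' = m.
Proof.
move=> [genS minS].
have antiS s m : S s -> S m -> (s <= m)%MM -> s = m.
  move=> Ss Sm le_sm; case: (eqVneq s m) => // ne_sm.
  pose T m' := S m' /\ m' <> m.
  have genT : generates T I.
    move=> f; rewrite genS; split=> If J HJ TJ; apply: If => // m'; last first.
      by case=> Sm' _; apply: TJ.
    move=> Sm'; case: (eqVneq m' m) => [->|/eqP ne]; last exact: TJ.
    have [_ _ HM] := HJ; rewrite -(submK le_sm) mpolyXD; apply: HM.
    by apply: TJ; split=> //; apply/eqP.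
  by have [_ []] := minS T (fun _ => @proj1 _ _) genT m Sm.
move=> m; split=> [Sm|[Im minm]].
  split=> [|m' /genS/ideal_ofXP[s Ss le_sm'] le_m'm].
    by apply/genS; apply: ideal_of_gen.
  have eq_sm := antiS _ _ Ss Sm (lepm_trans le_sm' le_m'm).
  subst s; apply/mnmP=> i; apply/eqP; rewrite eqn_leq.
  by rewrite (mnm_lepP le_sm') (mnm_lepP le_m'm).
have /genS/ideal_ofXP[s Ss le_sm] := Im.
by rewrite -(minm s) //; apply/genS; apply: ideal_of_gen.
Qed.

Lemma minimal_generating_uniq S T I :
  minimal_generating S I -> minimal_generating T I -> forall m, S m <-> T m.
Proof.
move=> minS minT m.
by rewrite (minimal_generatingE minS) (minimal_generatingE minT).
Qed.

Lemma mingens_minimal I :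
  monomial_ideal I -> minimal_generating (mingens I) I.
Proof.
move=> [S genS].
pose G m := I 'X_[m] /\ forall m', I 'X_[m'] -> (m' <= m)%MM -> m' = m.
have exG m : I 'X_[m] -> exists2 s, G s & (s <= m)%MM.
  have [k] := ubnP (mdeg m); elim: k m => // k IHk m lt_mk Im.
  apply: NNPP => noG; apply: (noG); exists m; last exact: lepm_refl.
  split=> // m' Im' le_m'm.
  case: (eqVneq m' m) => // ne_m'm; case: (IHk m') => //.
    apply: leq_trans (_ : mdeg m <= k)%N => //.
    rewrite -(submK le_m'm) mdegD -{1}[mdeg m']add0n ltn_add2r lt0n mdeg_eq0.
    apply: contra ne_m'm => /eqP eq0.
    by have /eqP := submK le_m'm; rewrite eq0 add0m.
  move=> s Gs le_sm'; case: noG.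
  by exists s => //; apply: lepm_trans le_sm' le_m'm.
have minG : minimal_generating G I.
  split=> [f|T TG genT m [Im minm]].
    rewrite genS; split=> If J HJ GJ; apply: If => // m; last first.
      by case=> /genS Im _; apply: Im => // s Ss; apply: GJ.
    move=> Sm; have [|s Gs le_sm] := exG m; first by apply/genS; apply: ideal_of_gen.
    have [_ _ HM] := HJ; rewrite -(submK le_sm) mpolyXD; apply: HM.
    exact: GJ.
  have /genT/ideal_ofXP[s Ts le_sm] := Im.
  by rewrite -(minm s) //; have [] := TG s Ts.
have mingensE m : mingens I m <-> G m.
  split=> [[T minT Tm]|Gm]; last by exists G.
  by apply/(minimal_generating_uniq minT minG).
have [genG minG'] := minG; split=> [f|T TG genT m /mingensE].
  rewrite genG; split=> If J HJ GJ; apply: If => // m Gm; apply: GJ.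
    exact/mingensE.
  exact/mingensE.
by apply: minG' => // m'; move/TG/mingensE.
Qed.

End MonomialIdeals.

(* Main.v *)
Require Import Defs.
From mathcomp Require Import all_boot all_order all_algebra.
From mathcomp Require Import mpoly.

(** Let u and v be squarefree minimal generators of I that agree before t, with
    v_t < u_t.  Then u_t = 1 and v_t = 0, so the monomial w = x_t (v / x_l) that
    the exchange property of I provides is still squarefree.  It has the degree
    of v, the common degree of the generators of I, so it is itself a minimal
    generator of I ([mingens_of_mdeg]) and therefore lies in the squarefree
    part.  The exchange property of I applies to the generators of the
    squarefree part because these are squarefree minimal generators of I
    ([mingens_squarefree_part]). *)

Set Implicit Arguments.
Unset Strict Implicit.
Unset Printing Implicit Defensive.

Section MinimalGenerators.

Variables (K : fieldType) (n : nat).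
Implicit Types (I : {mpoly K[n]} -> Prop) (S : 'X_{1..n} -> Prop).
Implicit Types m w : 'X_{1..n}.

Lemma mingens_ideal_of S m : mingens (ideal_of (K := K) S) m -> S m.
Proof.
case=> T minT /(minimal_generatingE minT)[/ideal_ofXP[s Ss le_sm] minm].
by rewrite -(minm s) //; apply: ideal_of_gen.
Qed.

Lemma mingens_squarefree_part I m :
  mingens (squarefree_part I) m -> mingens I m /\ squarefree m.
Proof. exact: mingens_ideal_of. Qed.

Lemma lepm_mdeg_eq m w : (m <= w)%MM -> mdeg m = mdeg w -> m = w.
Proof.
move=> le_mw eq_deg; have /eqP := congr1 mdeg (submK le_mw).
rewrite mdegD eq_deg -{2}[mdeg w]add0n eqn_add2r mdeg_eq0 => /eqP eq0.
by rewrite -(submK le_mw) eq0 add0m.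
Qed.

Lemma mingens_of_mdeg I d w :
  monomial_ideal I -> (forall m, mingens I m -> mdeg m = d) ->
  I 'X_[w] -> mdeg w = d -> mingens I w.
Proof.
move=> monI degI Iw deg_w; have [genI _] := mingens_minimal monI.
have /genI/ideal_ofXP[s Gs le_sw] := Iw.
by rewrite -(lepm_mdeg_eq le_sw) // (degI s Gs).
Qed.

End MinimalGenerators.

Lemma mdeg_exchange n (v : 'X_{1..n}) (t l : 'I_n) :
  (U_(l) <= v)%MM -> mdeg (U_(t) + (v - U_(l)))%MM = mdeg v.
Proof. by move=> le_lv; rewrite -{2}(submK le_lv) !mdegD !mdeg1 addnC. Qed.

Lemma squarefree_exchange n (v : 'X_{1..n}) (t l : 'I_n) :
  squarefree v -> v t = 0 -> squarefree (U_(t) + (v - U_(l)))%MM.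
Proof.
move=> sqv vt0 i; rewrite mnmDE mnmBE !mnm1E.
have [<-|_] := eqVneq t i; first by rewrite vt0.
exact: leq_trans (leq_subr _ _) (sqv i).
Qed.

Theorem lemma2p3 (K : fieldType) (n : nat) (I : {mpoly K[n]} -> Prop)
  (hI : weakly_polymatroidal I) : weakly_polymatroidal (squarefree_part I).
Proof.
have [monI [d degI] exchI] := hI; split.
- by exists (fun m => mingens I m /\ squarefree m).
- by exists d => m /mingens_squarefree_part[/degI].
move=> u v /mingens_squarefree_part[Gu sqfu] /mingens_squarefree_part[Gv sqfv].
move=> t eq_uv lt_vu.
have [l [lt_tl le_lv Iw]] := exchI u v Gu Gv t eq_uv lt_vu.
exists l; split=> //; move: Iw; rewrite -mpolyXD => Iw.
apply: ideal_of_gen; split.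
  by apply: (mingens_of_mdeg monI degI Iw); rewrite mdeg_exchange // degI.
have vt0 : v t = 0 by apply/eqP; rewrite -leqn0 -ltnS (leq_trans lt_vu).
exact: squarefree_exchange.
Qed.
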